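(* The reducibility value of a solitaire Clobber game on a cycle is computable in linear time (in the number of pawns $n$ of the initial conformation).
   Context: Solitaire Clobber on a cycle: an initial conformation is a cyclic word $c=c_1\cdots c_n$ ($n\ge 3$), $c_i\in\{\bullet,\circ\}$; a pawn of color $c_i$ (black or white) is placed on position $i$, for each $i\in\mathbb Z/n\mathbb Z$, and positions $i$ and $i+1$ (indices modulo $n$) are adjacent. A legal move consists in moving a pawn from its position onto an adjacent position occupied by a pawn of the opposite color; that latter pawn is removed, and the position left becomes empty. The single player may move a pawn of either color at each turn. The reducibility value of $c$ is the smallest number of remaining pawns that can be obtained by a finite sequence of legal moves starting from $c$. Time is counted in elementary operations in the usual sense of algorithm analysis. *)

(* Defs.v *)
From HB Require Import structures.
From mathcomp Require Import all_boot.

Set Implicit Arguments.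
Unset Strict Implicit.
Unset Printing Implicit Defensive.

(** * Solitaire Clobber on a cycle *)

(* A color is a boolean: [true] is black, [false] is white.  The word
   [c_1 ... c_n] is the tuple [c] with [c_(i+1) = tnth c i], and the positions
   Z/nZ are ['I_n], on which [ordS] is [i |-> i + 1 mod n]. *)

(* [None] is an empty position, [Some a] a position occupied by a pawn of
   color [a]. *)
Definition position_state (n : nat) := {ffun 'I_n -> option bool}.

Definition initial_state (n : nat) (c : n.-tuple bool) : position_state n :=
  [ffun i => Some (tnth c i)].

Definition adjacent (n : nat) (i j : 'I_n) : bool :=
  (j == ordS i) || (i == ordS j).

Definition can_clobber (n : nat) (s : position_state n) (i j : 'I_n) : bool :=
  match s i, s j with
  | Some a, Some b => adjacent i j && (a != b)
  | _, _ => false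
  end.

Definition clobber (n : nat) (s : position_state n) (i j : 'I_n) :
    position_state n :=
  [ffun k => if k == i then None else if k == j then s i else s k].

Definition legal_move (n : nat) (s s' : position_state n) : bool :=
  [exists i, exists j, can_clobber s i j && (s' == clobber s i j)].

Definition pawns (n : nat) (s : position_state n) : nat :=
  #|[set i | s i != None]|.

(* [connect] is the reflexive transitive closure. *)
Definition reducibility_value (n : nat) (c : n.-tuple bool) : nat :=
  pawns [arg min_(s < initial_state c |
                  connect (@legal_move n) (initial_state c) s) pawns s].

(** * Random access machines with unit cost *)

(* [r], [r1], [r2] are register numbers; [R] denotes the registers and [M] the
   memory.
     [IConst r v]      R[r] := v
     [IAdd r r1 r2]    R[r] := R[r1] + R[r2]
     [ISub r r1 r2]    R[r] := R[r1] - R[r2], truncated at 0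
     [IRead r r1]      R[r] := M[R[r1]]
     [IWrite r1 r2]    M[R[r1]] := R[r2]
     [IJumpz r l]      jump to the instruction number l (from 0) if R[r] = 0
     [IHalt]           stop, the output is R[0] *)
Inductive instr : Type :=
  | IConst of nat & nat
  | IAdd of nat & nat & nat
  | ISub of nat & nat & nat
  | IRead of nat & nat
  | IWrite of nat & nat
  | IJumpz of nat & nat
  | IHalt.

Definition program := seq instr.

Record machine : Type := Machine {
  pc : nat;
  reg : nat -> nat;
  mem : nat -> nat }.

(* Registers only receive numbers [< W]; exceeding this bound is an error. *)
Definition set_reg (W : nat) (m : machine) (r v : nat) : option machine :=
  if v < W then Some (Machine (pc m).+1 [eta reg m with r |-> v] (mem m))
  else None.

Definition step (W : nat) (i : instr) (m : machine) : option machine :=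
  let R := reg m in
  match i with
  | IConst r v => set_reg W m r v
  | IAdd r r1 r2 => set_reg W m r (R r1 + R r2)
  | ISub r r1 r2 => set_reg W m r (R r1 - R r2)
  | IRead r r1 => set_reg W m r (mem m (R r1))
  | IWrite r1 r2 => Some (Machine (pc m).+1 R [eta mem m with R r1 |-> R r2])
  | IJumpz r l => Some (Machine (if R r == 0 then l else (pc m).+1) R (mem m))
  | IHalt => None
  end.

(* The output of [P] started from [m], provided that [P] reaches [IHalt] after
   executing at most [t] instructions, without error. *)
Fixpoint run (W : nat) (P : program) (t : nat) (m : machine) : option nat :=
  match onth P (pc m) with
  | None => None
  | Some IHalt => Some (reg m 0)
  | Some i => if t is t'.+1 then obind (run W P t') (step W i m) else None
  end.

(* Register 0 contains the length of the input word, cells 0, ..., n - 1 of the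
   memory contain its letters, everything else is 0. *)
Definition input (n : nat) (c : n.-tuple bool) : machine :=
  Machine 0 [eta (fun=> 0) with 0 |-> n]
    (fun i => nth 0 [seq nat_of_bool b | b <- c] i).

(* A single program handles the inputs of all lengths [n >= n0], executing O(n)
   instructions on words of O(log n) bits (the numbers [< n ^ k]).  The bound
   on the words excludes hiding work in the arithmetic of large integers. *)
Definition linear_time_computable (n0 : nat)
    (f : forall n : nat, n.-tuple bool -> nat) : Prop :=
  exists (P : program) (C k : nat),
    forall n : nat, n0 <= n -> forall c : n.-tuple bool,
      run (n ^ k) P (C * n) (input c) = Some (f n c).

(* Main.v *)
Require Import Defs.
From mathcomp Require Import all_boot.
From mathcomp Require Import zify.

Set Implicit Arguments.
Unset Strict Implicit.
Unset Printing Implicit Defensive.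

(** The pawns that remain at the end of a game cut the cycle into segments, each
    of which has been reduced to one pawn by moves of its two end pawns inwards.
    Such a segment is a single letter or has the form a b^k a^l b with a <> b.
    Hence the reducibility value is the least number of segments in a
    factorization of the cyclic word into such words.  A factorization is a
    closed walk around the cycle in an automaton with five phases, its cost being
    the number of segments; a legal move amounts to changing the phase of a
    single position, at constant cost.  The cheapest closed walk is found in
    linear time by dynamic programming, once for each phase at the origin. *)

(** * The phase automaton and the cost of closed walks *)

(* Positions inside a segment a b^k a^l b with a <> b, just before a letter is
   read: [front a] inside b^k b, [back a] inside a^l b.  [boundary] is the gap
   between two segments; a segment may also be a single letter. *)
Definition phase := option (bool * bool).
Notation boundary := (@None (bool * bool)).
Notation front a := (Some (false, a)).
Notation back a := (Some (true, a)).

Definition reads (x : bool) (q q' : phase) : bool :=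
  match q with
  | None => (q' == boundary) || (q' == front x)
  | front a => if x == a then q' == back a
               else (q' == boundary) || (q' == front a)
  | back a => if x == a then q' == back a else q' == boundary
  end.

(* An empty position is only allowed between two segments. *)
Definition reads_cell (x : option bool) (q q' : phase) : bool :=
  if x is Some a then reads a q q' else (q == boundary) && (q' == boundary).

Definition walk (n : nat) (s : position_state n) (g : 'I_n -> phase) : Prop :=
  forall i, reads_cell (s i) (g i) (g (ordS i)).

Definition cost (n : nat) (s : position_state n) (g : 'I_n -> phase) : nat :=
  \sum_i ((g i == boundary) && (s i != None)).

Definition retarget (n : nat) (g : 'I_n -> phase) (i : 'I_n) (q : phase) :=
  fun k => if k == i then q else g k.

Lemma ordS_neq (n : nat) (i : 'I_n) : 1 < n -> ordS i != i.
Proof.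
move=> n1; apply/eqP => /(congr1 val) /=.
have := ltn_ord i; rewrite leq_eqVlt => /orP[/eqP e|h].
  by rewrite e modnn; lia.
by rewrite modn_small //; lia.
Qed.

Lemma cost_boundary (n : nat) (s : position_state n) :
  cost s (fun=> boundary) = pawns s.
Proof.
rewrite /cost /pawns -sum1_card [RHS]big_mkcond; apply: eq_bigr => i _.
by rewrite inE eqxx; case: (s i).
Qed.

Lemma cost_eq2 (n : nat) (s s' : position_state n) (g g' : 'I_n -> phase) (i j : 'I_n) :
  i != j ->
  ((g i == boundary) && (s i != None)) + ((g j == boundary) && (s j != None))
  = ((g' i == boundary) && (s' i != None))
    + ((g' j == boundary) && (s' j != None)) ->
  (forall k, k != i -> k != j -> g k = g' k /\ s k = s' k) ->
  cost s g = cost s' g'.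
Proof.
move=> ij eij e; have ji : j != i by rewrite eq_sym.
rewrite /cost (bigD1 i) // (bigD1 j) //= addnA eij.
rewrite [RHS](bigD1 i) // [in RHS](bigD1 j) //= addnA.
congr (_ + _); apply: eq_bigr => k /andP[ki kj].
by have [-> ->] := e k ki kj.
Qed.

(** * From games to closed walks *)

(** The vacated position [i] has [boundary] on both sides in [g']. After a forward move, [front a]
    at [j] lets [b] lead wherever [a] led from [boundary]. After a backward move, a suitable phase
    other than [boundary] at [i] lets [b] be read before the closing [a]. *)
Lemma walk_unmove (n : nat) (s s' : position_state n) (g' : 'I_n -> phase) :
  1 < n -> legal_move s s' -> walk s' g' ->
  exists g, [/\ walk s g, cost s g = cost s' g' & exists i, g i = boundary].
Proof.
move=> n1 /existsP[i /existsP[j /andP[+ /eqP s'E]]] wg'.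
rewrite /can_clobber; case si: (s i) => [a|//]; case sj: (s j) => [b|//].
case/andP=> adj ab.
have ij : i != j by apply: contraNneq ab => eij; move: sj; rewrite -eij si => -[->].
have ji : j != i by rewrite eq_sym.
have s'i : s' i = None by rewrite s'E ffunE eqxx.
have s'j : s' j = Some a by rewrite s'E ffunE eq_sym (negPf ij) eqxx.
have s'k k : k != i -> k != j -> s' k = s k.
  by move=> ki kj; rewrite s'E ffunE (negPf ki) (negPf kj).
have := wg' i; rewrite s'i => /andP[/eqP g'i /eqP g'Si].
have := wg' j; rewrite s'j /= => g'j.
case/orP: adj => /eqP eij.
- exists (retarget g' j (front a)); split.
  + move=> k; rewrite /retarget; have [->|kj] := eqVneq k j.
      rewrite sj /= (negPf (ordS_neq _ n1)).
      rewrite -eij in g'Si; rewrite g'Si /= in g'j.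
      by move: ab g'j; case: (a); case: (b).
    have [ki|ki] := eqVneq k i.
      by rewrite ki eij eqxx si g'i /= eqxx.
    by rewrite eij (inj_eq (can_inj (@ordSK _))) (negPf ki) -s'k //; apply: wg'.
  + apply: (cost_eq2 ij).
      rewrite /retarget eqxx (negPf ij) g'i si s'i s'j sj -eij in g'Si *.
      by rewrite g'Si.
    by move=> k ki kj; rewrite /retarget (negPf kj) s'k.
  + by exists i; rewrite /retarget (negPf ij).
- have [q qj qi] : exists2 q, reads b (g' j) q & reads a q boundary && (q != boundary).
    rewrite -eij g'i in g'j; move: g'j ab.
    by case: (g' j) => [[[] []]|]; case: (a) (b) => [] [] //= _ _;
      do ?[by exists (front true)|by exists (front false)
          |by exists (back true)|by exists (back false)].
  case/andP: qi => qi qN.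
  exists (retarget g' i q); split.
  + move=> k; rewrite /retarget; have [->|ki] := eqVneq k i.
      by rewrite si /= (negPf (ordS_neq _ n1)) g'Si.
    have [->|kj] := eqVneq k j; first by rewrite -eij eqxx sj.
    by rewrite eij (inj_eq (can_inj (@ordSK _))) (negPf kj) -s'k //; apply: wg'.
  + apply: (cost_eq2 ij).
      by rewrite /retarget eqxx (negPf ji) (negPf qN) s'i s'j sj !andbF.
    by move=> k ki kj; rewrite /retarget (negPf ki) s'k.
  + by exists (ordS i); rewrite /retarget (negPf (ordS_neq _ n1)).
Qed.

(** Backward induction along the game: in the final state each remaining pawn is a segment of its
    own. *)
Lemma walk_of_reachable (n : nat) (s t : position_state n) :
  1 < n -> connect (@legal_move n) s t ->
  exists g, [/\ walk s g, cost s g = pawns t & exists i, g i = boundary].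
Proof.
move=> n1 /connectP[p + ->]; elim: p s => [|s' p IH] s /=.
  move=> _; exists (fun=> boundary); split; last by exists (Ordinal (ltnW n1)).
    by move=> i; rewrite /reads_cell; case: (s i).
  exact: cost_boundary.
case/andP=> ss' /IH[g' [wg' cg' _]].
by have [g [wg cg bg]] := walk_unmove n1 ss' wg'; exists g; split; rewrite // cg.
Qed.

(** * From closed walks to games *)

Lemma cyclic_exit (n : nat) (A : pred 'I_n) (i j : 'I_n) :
  A i -> ~~ A j -> exists2 k, A k & ~~ A (ordS k).
Proof.
move=> Ai Aj; case: (pickP [pred k | A k && ~~ A (ordS k)]) => [k /andP[]|nA].
  by exists k.
have clo k : A k -> A (ordS k) by move=> Ak; have /= := nA k; rewrite Ak => /negbFE.
case/negP: Aj.
have iA m : A (iter m (@ordS n) i) by elim: m => //= m /clo.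
(* The successor generates Z/nZ: [i + (n - i + j)] is [j] modulo [n]. *)
suff <- : iter (n - i + j) (@ordS n) i = j by [].
apply: val_inj.
have -> m : val (iter m (@ordS n) i) = (i + m) %% n.
  elim: m => [|m IH]; first by rewrite addn0 modn_small.
  by rewrite iterS /= IH -addn1 modnDml addn1 addnS.
by rewrite addnA subnKC 1?ltnW // modnDl modn_small.
Qed.

(** Termination measure: it decreases with each move extracted from a walk. *)
Definition pending (n : nat) (g : 'I_n -> phase) : nat :=
  \sum_i (g i != boundary).

Lemma pending_retarget (n : nat) (g : 'I_n -> phase) j :
  g j != boundary -> pending (retarget g j boundary) < pending g.
Proof.
move=> gj; rewrite /pending (bigD1 j) //= [ltnRHS](bigD1 j) //=.
rewrite /retarget eqxx gj ltnS.
by apply: leq_sum => i /negPf ->.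
Qed.

Lemma legal_moveI (n : nat) (s : position_state n) (i j : 'I_n) (a : bool) :
  s i = Some a -> s j = Some (~~ a) -> adjacent i j ->
  legal_move s (clobber s i j).
Proof.
move=> si sj ij; apply/existsP; exists i; apply/existsP; exists j.
by rewrite /can_clobber si sj ij eqxx /=; case: (a).
Qed.

(** Segments are consumed from their right end while some back phase is left, then from their left
    end. *)
Lemma walk_move (n : nat) (s : position_state n) (g : 'I_n -> phase) i0 j0 :
  1 < n -> walk s g -> g i0 = boundary -> g j0 != boundary ->
  exists s' j, let g' := retarget g j boundary in
  [/\ legal_move s s', walk s' g', cost s' g' = cost s g & g j != boundary].
Proof.
move=> n1 wg gi0 gj0.
pose inback k := if g k is back _ then true else false.
case: (pickP inback) => [k0 bk0|nb].
(* Here [j] ends a run of back phases, so it carries the last letter [~~ a] of its segment and its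
   predecessor [h] carries [a]: the pawn on [j] clobbers [h]. *)
- have [|j] := @cyclic_exit n inback k0 i0 bk0; first by rewrite /inback gi0.
  have jh : ordS (ord_pred j) = j by apply: ord_predK.
  move: (ord_pred j) jh => h jh.
  have hj : h != j by rewrite -jh eq_sym ordS_neq.
  have := wg h; have := wg j; rewrite /inback jh.
  case gj: (g j) => [[[] a]|] //=; case sj: (s j) => [b|] //=.
  case: (eqVneq b a) => [_ /eqP-> //|ba] /eqP gSj.
  case sh: (s h) => [x|]; last by case/andP.
  move=> rh _ _.
  have xa : x = a.
    by move: rh; case: (g h) => [[[] []]|]; case: (x) (a) => [] [].
  rewrite {x}xa in sh rh.
  have bE : b = ~~ a by case: (a) (b) ba => [] [].
  rewrite {b ba}bE in sj.
  exists (clobber s j h), j; split; rewrite ?gj //.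
  + apply: legal_moveI sj _ _; first by rewrite negbK.
    by rewrite /adjacent jh eqxx orbT.
  + move=> k; rewrite /retarget /clobber ffunE.
    have [->|kj] := eqVneq k j; first by rewrite (negPf (ordS_neq _ n1)) gSj.
    have [->|kh] := eqVneq k h.
      rewrite jh eqxx sj /=.
      by move: rh; case: (g h) => [[[] []]|]; case: (a).
    by rewrite -jh (inj_eq (can_inj (@ordSK _))) (negPf kh); apply: wg.
  + apply: (cost_eq2 hj).
      rewrite /retarget /clobber !ffunE eqxx (negPf hj) gj eqxx sj sh /= andbT.
      by case: (g h).
    by move=> k kh kj; rewrite /retarget /clobber ffunE (negPf kj) (negPf kh).
(* Without back phases, a segment opened by [a] at [i] continues with [~~ a], so the pawn on [i]
   clobbers its successor. *)
- have [||i] := @cyclic_exit n (fun k => g k == boundary) i0 j0; rewrite ?gi0 //.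
  move=> /eqP gi gSi.
  have ij : i != ordS i by rewrite eq_sym ordS_neq.
  have := wg i; rewrite gi; case si: (s i) => [a|] /=; last by rewrite (negPf gSi).
  rewrite (negPf gSi) /= => /eqP gj.
  have := wg (ordS i); rewrite gj; case sj: (s (ordS i)) => [b|] //=.
  case: eqP => [_ /eqP gb|/eqP ba rj].
    by have := nb (ordS (ordS i)); rewrite /inback gb.
  have bE : b = ~~ a by case: (a) (b) ba => [] [].
  rewrite {b ba}bE in sj.
  exists (clobber s i (ordS i)), (ordS i); split; rewrite ?gj //.
  + by apply: legal_moveI si sj _; rewrite /adjacent eqxx.
  + move=> k; rewrite /retarget /clobber ffunE.
    have [->|ki] := eqVneq k i; first by rewrite eqxx (negPf ij) gi.
    rewrite (inj_eq (can_inj (@ordSK _))) (negPf ki).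
    have [->|kj] := eqVneq k (ordS i); first by rewrite si /=.
    exact: wg.
  + apply: (cost_eq2 ij).
      rewrite /retarget /clobber !ffunE !eqxx (negPf ij) (negPf (ordS_neq _ n1)).
      by rewrite gj gi si sj.
    by move=> k ki kj; rewrite /retarget /clobber ffunE (negPf kj) (negPf ki).
Qed.

Lemma reachable_of_walk (n : nat) (s : position_state n) (g : 'I_n -> phase) i0 :
  1 < n -> walk s g -> g i0 = boundary ->
  exists2 t, connect (@legal_move n) s t & pawns t = cost s g.
Proof.
move=> n1; have [m] := ubnP (pending g); elim: m => // m IH in s g *.
rewrite ltnS => gm wg gi0.
case: (pickP (fun j => g j != boundary)) => [j0 gj0|gN]; last first.
  exists s; rewrite ?connect0 // -cost_boundary; apply: eq_bigr => i _.
  by have /negbFE/eqP -> := gN i.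
have [s' [j [/= ss' wg' <- gj]]] := walk_move n1 wg gi0 gj0.
have [||t s't <-] := IH _ _ _ wg'.
- exact: leq_trans (pending_retarget gj) gm.
- by rewrite /retarget gi0 if_same.
by exists t => //; apply: connect_trans (connect1 ss') s't.
Qed.

(** * The reducibility value and constant words *)

Lemma reducibility_valueP (n : nat) (c : n.-tuple bool) :
  (exists2 t, connect (@legal_move n) (initial_state c) t
            & pawns t = reducibility_value c) /\
  (forall t, connect (@legal_move n) (initial_state c) t ->
     reducibility_value c <= pawns t).
Proof.
rewrite /reducibility_value; case: arg_minnP => [|t ct mt]; first exact: connect0.
by split=> [|t' /mt]; first exists t.
Qed.

Lemma pawns_initial (n : nat) (c : n.-tuple bool) : pawns (initial_state c) = n.
Proof.
rewrite /pawns -[RHS](card_ord n); apply: eq_card => i.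
by rewrite !inE ffunE.
Qed.

Lemma reducibility_value_constant (n : nat) (c : n.-tuple bool) :
  (forall i j, tnth c i = tnth c j) -> reducibility_value c = n.
Proof.
move=> cc; have [[t /connectP[p pt tE] <-] _] := reducibility_valueP c.
case: p pt tE => [_ ->|s p]; first exact: pawns_initial.
case/andP=> /existsP[i /existsP[j /andP[]]].
by rewrite /can_clobber !ffunE (cc i j) eqxx andbF.
Qed.

Lemma walk_initial (n : nat) (c : n.-tuple bool) (g : 'I_n -> phase) :
  walk (initial_state c) g <->
  forall i, reads (tnth c i) (g i) (g (ordS i)).
Proof. by split=> h i; have := h i; rewrite ffunE. Qed.

Lemma cost_initial (n : nat) (c : n.-tuple bool) (g : 'I_n -> phase) :
  cost (initial_state c) g = \sum_i (g i == boundary).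
Proof. by apply: eq_bigr => i _; rewrite ffunE andbT. Qed.

(** A back phase can only be left through [boundary], so the walk stays either in back phases or in
    front phases. Its color is then fixed, and only one letter can be read. *)
Lemma constant_of_walk (n : nat) (c : n.-tuple bool) (g : 'I_n -> phase) :
  walk (initial_state c) g -> (forall i, g i != boundary) ->
  forall i j, tnth c i = tnth c j.
Proof.
move=> /walk_initial wg gN i j.
pose inback k := if g k is back _ then true else false.
have cS k : tnth c k = tnth c (ordS k).
  have same u v : inback u = inback v.
    suff imp u' v' : inback u' -> inback v' by apply/idP/idP; apply: imp.
    move=> bu; apply: contraT => /(cyclic_exit bu)[w].
    have := wg w; have := gN (ordS w); rewrite /inback.
    by case: (g w) => [[[] a]|] //= gSN; case: eqP => _ /eqP e; move: gSN; rewrite e.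
  have := wg k; have := wg (ordS k).
  have := same (ordS k) k; have := same (ordS (ordS k)) k.
  have := gN k; have := gN (ordS k); have := gN (ordS (ordS k)).
  rewrite /inback; case: (g k) => [[[] []]|] //; case: (g (ordS k)) => [[[] []]|] //;
    case: (g (ordS (ordS k))) => [[[] []]|] //=;
    by case: (tnth c k); case: (tnth c (ordS k)).
apply: contraTeq isT => cij.
have [|k /eqP <-] := @cyclic_exit n (fun k => tnth c k == tnth c i) i j (eqxx _).
  by rewrite eq_sym.
by rewrite -cS eqxx.
Qed.

(** * Dynamic programming on the cycle cut open at position 0 *)

(* One step of the backward dynamic programming: [v q'] is the least cost of
   reading the rest of the word from phase [q']. *)
Definition cheapest_step (x : bool) (v : phase -> nat) (q : phase) : nat :=
  match q with
  | None => minn (v boundary) (v (front x)) + 1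
  | front a => if x == a then v (back a) else minn (v boundary) (v (front a))
  | back a => if x == a then v (back a) else v boundary
  end.

(* The singleton segments give a closed walk of cost [n], so [n] can stand for
   an infinite cost. *)
Definition terminal_cost (n : nat) (f q : phase) : nat := if q == f then 0 else n.

Definition cheapest (n : nat) (f : phase) (w : seq bool) : phase -> nat :=
  foldr cheapest_step (terminal_cost n f) w.

Lemma cheapest_step_le x v q q' :
  reads x q q' -> cheapest_step x v q <= (q == boundary) + v q'.
Proof.
case: q => [[[] a]|] /=.
- by case: eqP => _ /eqP ->.
- by case: eqP => _; [move/eqP->|case/orP=> /eqP->; rewrite (geq_minl, geq_minr)].
- by rewrite addnC leq_add2l => /orP[] /eqP ->; rewrite (geq_minl, geq_minr).
Qed.

Lemma cheapest_step_ex x v q :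
  exists2 q', reads x q q' & cheapest_step x v q = (q == boundary) + v q'.
Proof.
case: q => [[[] a]|] /=.
- by case: eqP => _; eexists; rewrite ?eqxx.
- case: eqP => _; first by eexists.
  case: (leqP (v boundary) (v (front a))) => _.
    by exists boundary.
  by exists (front a); rewrite ?eqxx ?orbT.
- case: (leqP (v boundary) (v (front x))) => _.
    by exists boundary; rewrite // addnC.
  by exists (front x); rewrite ?eqxx ?orbT // addnC.
Qed.

Lemma cheapest_le n f w (g : nat -> phase) :
  (forall i, i < size w -> reads (nth false w i) (g i) (g i.+1)) ->
  cheapest n f w (g 0)
    <= \sum_(i < size w) (g i == boundary) + terminal_cost n f (g (size w)).
Proof.
elim: w g => [|x w IH] g gw /=; first by rewrite big_ord0.
rewrite big_ord_recl -addnA.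
apply: leq_trans (cheapest_step_le _ (gw 0 _)) _ => //.
by rewrite leq_add2l; apply: (IH (fun i => g i.+1)) => i; apply: (gw i.+1).
Qed.

Lemma cheapest_ex n f w q : exists g : nat -> phase,
  [/\ g 0 = q, forall i, i < size w -> reads (nth false w i) (g i) (g i.+1)
    & cheapest n f w q
      = \sum_(i < size w) (g i == boundary) + terminal_cost n f (g (size w))].
Proof.
elim: w q => [|x w IH] q /=; first by exists (fun=> q); rewrite big_ord0.
have [q' rq ->] := cheapest_step_ex x (cheapest n f w) q.
have [g [g0 gr ->]] := IH q'.
exists (fun i => if i is i'.+1 then g i' else q); split=> //.
  by case=> [|i] //=; rewrite ?g0 // => /gr.
by rewrite big_ord_recl addnA.
Qed.

Definition phases : seq phase :=
  [:: boundary; front false; front true; back false; back true].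

Definition closed_cost (n : nat) (w : seq bool) (f : phase) :=
  cheapest n f w f.

(** Reducing indices modulo [n] unrolls the walk; its phases at 0 and [n] agree, so there is no
    terminal penalty. *)
Lemma closed_cost_le (n : nat) (c : n.-tuple bool) (g : 'I_n -> phase) :
  0 < n -> walk (initial_state c) g ->
  exists f, closed_cost n c f <= cost (initial_state c) g.
Proof.
move=> n0 /walk_initial wg; exists (g (Ordinal n0)).
pose h i := g (Ordinal (ltn_pmod i n0)).
have h0 : h 0 = g (Ordinal n0) by congr g; apply: val_inj; rewrite /= mod0n.
have hi (i : 'I_n) : h i = g i.
  by congr g; apply: val_inj; rewrite /= modn_small.
have hn : h n = g (Ordinal n0) by congr g; apply: val_inj; rewrite /= modnn.
rewrite /closed_cost -h0; apply: leq_trans (cheapest_le _ _ _) _.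
  rewrite size_tuple => i i_n; rewrite (hi (Ordinal i_n)).
  rewrite -[i]/(val (Ordinal i_n)) -(tnth_nth false).
  have -> : h (Ordinal i_n).+1 = g (ordS (Ordinal i_n)) by congr g; apply: val_inj.
  exact: wg.
rewrite size_tuple hn h0 /terminal_cost eqxx addn0 cost_initial.
by rewrite leq_eqVlt; apply/orP; left; apply/eqP; apply: eq_bigr => i _; rewrite hi.
Qed.

Lemma closed_cost_ex (n : nat) (c : n.-tuple bool) f :
  closed_cost n c f < n ->
  exists2 g, walk (initial_state c) g
    & cost (initial_state c) g = closed_cost n c f.
Proof.
rewrite /closed_cost; have [g [g0 gr ->]] := cheapest_ex n f c f.
(* A cost below [n] excludes the terminal penalty, so the linear walk closes up. *)
rewrite size_tuple /terminal_cost; case: eqP => [gn _|_]; last by lia.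
exists (fun i => g i); last by rewrite cost_initial addn0.
apply/walk_initial => i; have := gr i.
rewrite size_tuple (tnth_nth false) => /(_ (ltn_ord i)).
suff -> : g (ordS i) = g i.+1 by [].
rewrite /=; have := ltn_ord i; rewrite leq_eqVlt => /orP[/eqP->|].
  by rewrite modnn gn.
by move/modn_small->.
Qed.

Definition min_closed_cost (n : nat) (w : seq bool) : nat :=
  foldr minn (closed_cost n w boundary)
    [seq closed_cost n w f | f <- behead phases].

Lemma min_closed_cost_le n w f : min_closed_cost n w <= closed_cost n w f.
Proof.
rewrite /min_closed_cost /=.
by case: f => [[[] []]|]; rewrite !geq_min leqnn ?orbT.
Qed.

Lemma min_closed_cost_ex n w : exists f, min_closed_cost n w = closed_cost n w f.
Proof.
rewrite /min_closed_cost; elim: (behead phases) => [|q s [f IH]] /=.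
  by exists boundary.
by rewrite IH /minn; case: ifP => _; [exists q|exists f].
Qed.

(* Leaving [boundary] costs 1, so a closed walk of cost 0 avoids [boundary]; it
   stays in one phase and the word is constant. *)
Lemma reducibility_value_min (n : nat) (c : n.-tuple bool) : 1 < n ->
  reducibility_value c =
  if min_closed_cost n c == 0 then n else min_closed_cost n c.
Proof.
move=> n1; have [[t ct pt] mint] := reducibility_valueP c.
have [g [wg cg _]] := walk_of_reachable n1 ct.
have [f fg] := closed_cost_le (ltnW n1) wg.
have := leq_trans (min_closed_cost_le _ _ _) fg; rewrite cg pt => lev.
have [f' mf'] := min_closed_cost_ex n c.
have vn : reducibility_value c <= n.
  by rewrite -{2}(pawns_initial c); apply/mint/connect0.
(* A minimum of [n] or more may come from the penalty rather than from a walk; [lev] and [vn] then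
   force the value [n]. *)
have [m_n|n_m] := ltnP (min_closed_cost n c) n; last first.
  by case: eqP => [|_]; lia.
rewrite mf' in m_n; have [h wh] := closed_cost_ex m_n; rewrite -mf' => ch.
case: eqP => [m0|/eqP mN0].
  apply: reducibility_value_constant; apply: constant_of_walk wh _ => i.
  apply: contra_eqN m0 => hi; rewrite -ch cost_initial (bigD1 i) //= hi.
  by rewrite eqn0Ngt.
apply/eqP; rewrite eqn_leq lev andbT -ch.
(* A nonzero cost supplies a boundary position, with which the walk can be played as a game. *)
move: mN0; rewrite -ch cost_initial sum_nat_eq0 negb_forall => /existsP[i].
case hi: (h i == boundary) => // _; move/eqP in hi.
have [u /mint cu] := reachable_of_walk n1 wh hi.
by rewrite -(cost_initial c) => <-.
Qed.

(** * Straight-line code and its register bounds *)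

(** Constants are at most 1 so that a positive bound on the registers at most doubles. *)
Definition arithmetic (i : instr) : bool :=
  match i with
  | IConst _ v => v <= 1
  | IAdd _ _ _ | ISub _ _ _ => true
  | _ => false
  end.

Definition exec (i : instr) (R : nat -> nat) : nat -> nat :=
  match i with
  | IConst r v => [eta R with r |-> v]
  | IAdd r r1 r2 => [eta R with r |-> R r1 + R r2]
  | ISub r r1 r2 => [eta R with r |-> R r1 - R r2]
  | _ => R
  end.

Definition exec_all (cs : program) (R : nat -> nat) : nat -> nat :=
  foldl (fun R i => exec i R) R cs.

Lemma onth_drop (P : program) p i rest :
  drop p P = i :: rest -> onth P p = Some i /\ drop p.+1 P = rest.
Proof.
elim: P p => [|j P IH] [|p] //=; last exact: IH.
by case=> -> ->; rewrite drop0.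
Qed.

(* Each instruction at most doubles the largest register. *)
Lemma run_arithmetic W P cs rest p t R M B :
  drop p P = cs ++ rest -> all arithmetic cs ->
  0 < B -> (forall r, R r <= B) -> 2 ^ size cs * B < W ->
  run W P (size cs + t) (Machine p R M)
  = run W P t (Machine (p + size cs) (exec_all cs R) M).
Proof.
elim: cs p R B => [|i cs IH] p R B /=; first by rewrite addn0.
move=> dP /andP[ai acs] B0 RB BW.
have [oi dP'] := onth_drop dP.
have pow : 2 ^ (size cs).+1 * B = 2 ^ size cs * (2 * B) by rewrite expnS; lia.
have BW2 : 2 * B < W.
  apply: leq_ltn_trans BW; rewrite pow.
  by rewrite -{1}[2 * B]mul1n leq_mul2r expn_gt0 orbT.
have RB2 r : R r <= 2 * B by have := RB r; lia.
have BB : 0 < 2 * B by lia.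
rewrite pow in BW.
rewrite oi addnS -addSn; case: i ai {dP oi} => //= [r v|r r1 r2|r r1 r2] h.
- have vW : v < W by lia.
  rewrite /set_reg vW /=; apply: (IH _ _ (2 * B)) => // k /=.
  by case: eqP => // _; lia.
- have vW : R r1 + R r2 < W by have := RB r1; have := RB r2; lia.
  rewrite /set_reg vW /=; apply: (IH _ _ (2 * B)) => // k /=.
  by case: eqP => // _; have := RB r1; have := RB r2; lia.
- have vW : R r1 - R r2 < W by have := RB r1; lia.
  rewrite /set_reg vW /=; apply: (IH _ _ (2 * B)) => // k /=.
  by case: eqP => // _; have := RB r1; lia.
Qed.

(** * The program *)

(* Register 0 holds n, register 1 holds 0, register 2 holds 1, register 3 is the
   number of letters still to be read, register 4 is the current letter,
   registers 5 and 6 are scratch.  The register [cell f q] holds the least cost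
   from phase [q] to the final phase [f] on the letters read so far; the word is
   read from right to left. *)
Definition phase_index (q : phase) : nat :=
  match q with
  | None => 0
  | Some (l, a) => 1 + (2 * l + a)
  end.

Definition cell (f q : phase) : nat := 7 + (5 * phase_index f + phase_index q).

(* Minima are computed without jumps: min(a, b) = a - (a - b). *)
Definition update (x : bool) (f : phase) : program :=
  let e := cell f boundary in
  let kx := cell f (front x) in
  let ky := cell f (front (~~ x)) in
  let lx := cell f (back x) in
  let ly := cell f (back (~~ x)) in
  [:: ISub 5 e kx; ISub 5 e 5;
      IAdd kx lx 1;
      ISub 6 e ky; ISub ky e 6;
      IAdd ly e 1;
      IAdd e 5 2].

Definition body (x : bool) : program := flatten [seq update x f | f <- phases].

(** The operand [if q == f then 1 else 0] is a register number: register 1 holds 0 and register 0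
    holds [n], the two values of [terminal_cost]. *)
Definition setup : program :=
  [:: IConst 2 1; IAdd 3 0 1] ++
  [seq IAdd (cell f q) (if q == f then 1 else 0) 1 | f <- phases, q <- phases].

(** Register 5 carries the running minimum; [rev] follows the evaluation order of [foldr] in
    [min_closed_cost]. *)
Definition select : program :=
  IAdd 5 (cell boundary boundary) 1 ::
  flatten [seq [:: ISub 6 (cell f f) 5; ISub 5 (cell f f) 6]
          | f <- rev (behead phases)].

Definition head_pc : nat := size setup.
(** The 5 counts the four instructions of the loop head and the jump closing the black body. *)
Definition white_pc : nat := head_pc + 5 + size (body true).
Definition exit_pc : nat := white_pc + size (body false) + 1.
Definition halt_pc : nat := exit_pc + size select + 2.

(** Register 1 holds 0, so [IJumpz 1 head_pc] always jumps. A zero minimum in register 5 skips the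
    last addition and leaves [n] as the output. *)
Definition clobber_program : program :=
  setup ++
  [:: IJumpz 3 exit_pc; ISub 3 3 2; IRead 4 3; IJumpz 4 white_pc] ++
  body true ++ IJumpz 1 head_pc ::
  body false ++ IJumpz 1 head_pc ::
  select ++ [:: IJumpz 5 halt_pc; IAdd 0 5 1; IHalt].

(** * Effect of each block on the registers *)

Lemma body_cell (x : bool) (R : nat -> nat) (f q : phase) :
  R 1 = 0 -> R 2 = 1 ->
  exec_all (body x) R (cell f q) = cheapest_step x (fun q => R (cell f q)) q.
Proof.
move=> R1 R2; case: x; case: f => [[[] []]|]; case: q => [[[] []]|] /=;
  by rewrite ?R1 ?R2 ?addn0 ?minnE.
Qed.

(** Iterating the doubling estimate would give an exponential bound. A whole body only takes
    differences, copies and minima, with at most one increment, so the registers stay linear in [n]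
    over the loop. *)
Lemma body_bound (x : bool) (R : nat -> nat) B r :
  R 1 = 0 -> R 2 = 1 -> (forall r, R r <= B) -> exec_all (body x) R r <= B.+1.
Proof.
move=> R1 R2 RB.
have bound k : R k <= B.+1 by rewrite leqW.
have boundB k y : R k - y <= B by apply: leq_trans (leq_subr _ _) (RB k).
(* The cells end at register 31; later registers are untouched. *)
case: x; do 32 (case: r => [|r];
     first by rewrite /= ?R1 ?R2 ?addn0 ?addn1 ?ltnS ?leqW).
all: exact: bound.
Qed.

Lemma body_frame (x : bool) (R : nat -> nat) r :
  r \in [:: 0; 1; 2; 3; 4] -> exec_all (body x) R r = R r.
Proof. by rewrite !inE; case: x => /or4P[|||/orP[]] /eqP ->. Qed.

Lemma setup_cell n f q :
  exec_all setup [eta (fun=> 0) with 0 |-> n] (cell f q) = terminal_cost n f q.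
Proof. by case: f => [[[] []]|]; case: q => [[[] []]|]; rewrite /= addn0. Qed.

Lemma setup_bound n r :
  exec_all setup [eta (fun=> 0) with 0 |-> n] r <= n.+1.
Proof. by do 32 (case: r => [|r]; first by rewrite /= ?addn0); rewrite /=. Qed.

Lemma select_min n w (R : nat -> nat) :
  R 1 = 0 -> (forall f, R (cell f f) = closed_cost n w f) ->
  exec_all select R 5 = min_closed_cost n w.
Proof.
move=> R1 Rc; rewrite /min_closed_cost /= -!Rc !minnE.
by rewrite /= R1 addn0.
Qed.

Lemma select_frame (R : nat -> nat) r :
  r \in [:: 0; 1] -> exec_all select R r = R r.
Proof. by rewrite !inE => /orP[] /eqP ->. Qed.

(** * Execution within the time and word bounds *)

Lemma run_step W P i p R M m t :
  onth P p = Some i -> step W i (Machine p R M) = Some m ->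
  run W P t.+1 (Machine p R M) = run W P t m.
Proof. by move=> /= ->; case: i => [r v|r r1 r2|r r1 r2|r r1|r1 r2|r l|] // ->. Qed.

Record loop_state (n : nat) (w : seq bool) (i : nat) (R : nat -> nat) : Prop :=
  LoopState {
    loop_size : R 0 = n;
    loop_zero : R 1 = 0;
    loop_one : R 2 = 1;
    loop_index : R 3 = i;
    loop_cell : forall f q, R (cell f q) = cheapest n f (drop i w) q }.

Lemma size_body x : size (body x) = 35.
Proof. by case: x. Qed.

Lemma eq_cheapest_step x v v' : v =1 v' -> cheapest_step x v =1 cheapest_step x v'.
Proof. by move=> e [[[] a]|]; rewrite /= !e. Qed.

Lemma run_iteration n (w : seq bool) W i R B :
  loop_state n w i.+1 R -> i < size w ->
  0 < B -> i <= B -> (forall r, R r <= B) -> 2 ^ 35 * B < W ->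
  let M := nth 0 [seq nat_of_bool b | b <- w] in
  exists R', [/\ loop_state n w i R', forall r, R' r <= B.+1
    & forall t, run W clobber_program (40 + t) (Machine head_pc R M)
              = run W clobber_program t (Machine head_pc R' M)].
Proof.
case=> R0 R1 R2 R3 Rc iw B0 iB RB BW M.
have BW' : B < W.
  by apply: leq_ltn_trans BW; rewrite -{1}[B]mul1n leq_mul2r expn_gt0 orbT.
set x := nth false w i.
have Mi : M i = x by rewrite /M (nth_map false).
pose Ra := [eta [eta R with 3 |-> i] with 4 |-> nat_of_bool x].
have RaB r : Ra r <= B.
  rewrite /Ra /=; case: eqP => _; first by case: (x).
  by case: eqP.
exists (exec_all (body x) Ra); split.
- split; rewrite ?body_frame //.
  move=> f q; rewrite body_cell // (drop_nth false) // -/x.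
  apply: (@eq_cheapest_step _ _ (cheapest n f (drop i.+1 w))) => {}q.
  by rewrite -Rc /Ra; case: f => [[[] []]|]; case: q => [[[] []]|].
- by move=> r; apply: body_bound RaB.
move=> t.
(* Four instructions of the loop head, 35 of the body and one jump back. *)
have -> : 40 + t = (35 + t.+1).+4 by rewrite addnS.
rewrite (@run_step _ _ (IJumpz 3 exit_pc) _ _ _ (Machine head_pc.+1 R M)) //; last first.
  by rewrite /= R3.
rewrite (@run_step _ _ (ISub 3 3 2) _ _ _
  (Machine head_pc.+2 [eta R with 3 |-> i] M)) //; last first.
  by rewrite /= R3 R2 subn1 /= /set_reg (leq_ltn_trans iB BW').
rewrite (@run_step _ _ (IRead 4 3) _ _ _ (Machine head_pc.+3 Ra M)) //; last first.
  rewrite /= Mi /set_reg ifT //; apply: leq_ltn_trans BW'.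
  by apply: leq_trans B0; case: (x).
pose p := if x then head_pc + 4 else white_pc.
rewrite (@run_step _ _ (IJumpz 4 white_pc) _ _ _ (Machine p Ra M)); first last.
- by rewrite /= /p; case: (x).
- by [].
have dropE : drop p clobber_program = body x ++ drop (p + 35) clobber_program.
  by rewrite /p; case: (x).
have arith : all arithmetic (body x) by case: (x).
rewrite -(size_body x) in BW *.
rewrite (run_arithmetic _ _ dropE arith B0 RaB BW).
rewrite (@run_step _ _ (IJumpz 1 head_pc) _ _ _
  (Machine head_pc (exec_all (body x) Ra) M)) //.
  by rewrite size_body /p; case: (x).
have R'1 : exec_all (body x) Ra 1 = 0 by rewrite body_frame.
by rewrite /step [reg _ _]R'1.
Qed.

(** Each iteration raises [B] by one and lowers [i] by one, so [B + i] is invariant and a single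
    hypothesis on [W] serves the whole loop. *)
Lemma run_loop n (w : seq bool) W i R B :
  loop_state n w i R -> i <= size w ->
  0 < B -> size w <= B -> (forall r, R r <= B) -> 2 ^ 35 * (B + i) < W ->
  let M := nth 0 [seq nat_of_bool b | b <- w] in
  exists R', [/\ loop_state n w 0 R', forall r, R' r <= B + i
    & forall t, run W clobber_program (40 * i + t) (Machine head_pc R M)
              = run W clobber_program t (Machine head_pc R' M)].
Proof.
elim: i R B => [|i IH] R B Rs iw B0 wB RB BW M.
  by exists R; split=> // r; rewrite addn0.
have BW' : 2 ^ 35 * B < W.
  by apply: leq_ltn_trans BW; rewrite leq_mul2l leq_addr orbT.
have iB : i <= B by apply: leq_trans (ltnW iw) wB.
have [R' [R's R'B run1]] := run_iteration Rs iw B0 iB RB BW'.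
rewrite -addSnnS in BW.
have [R'' [R''s R''B run2]] := IH R' B.+1 R's (ltnW iw) isT (leqW wB) R'B BW.
exists R''; split=> // [r|t]; first by rewrite -addSnnS.
by rewrite mulnS -addnA run1 run2.
Qed.

Lemma run_halt W P p R M t :
  onth P p = Some IHalt -> run W P t (Machine p R M) = Some (R 0).
Proof. by case: t => [|t] /= ->. Qed.

Lemma run_select n (w : seq bool) W R B M t :
  loop_state n w 0 R ->
  0 < B -> (forall r, R r <= B) -> 2 ^ 35 * B < W ->
  run W clobber_program (12 + t) (Machine head_pc R M)
  = Some (if min_closed_cost n w == 0 then n else min_closed_cost n w).
Proof.
case=> R0 R1 _ R3 Rc B0 RB BW.
have Rw f : R (cell f f) = closed_cost n w f by rewrite Rc drop0.
have BW' k : k <= 35 -> 2 ^ k * B < W.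
  by move=> k35; apply: leq_ltn_trans BW; rewrite leq_mul2r leq_exp2l // k35 orbT.
set v := min_closed_cost n w.
have vW : v < W.
  have BW0 : B < W by have := BW' 0 isT; rewrite expn0 mul1n.
  apply: leq_ltn_trans BW0.
  by apply: leq_trans (min_closed_cost_le n w boundary) _; rewrite -Rw.
have size_select : size select = 9 by [].
have dropE : drop exit_pc clobber_program = select ++ drop (exit_pc + 9) clobber_program
  by [].
(* One jump out of the loop, nine instructions of [select], at most two for the output; [IHalt] uses
   no fuel. *)
have -> : 12 + t = (size select + t.+2).+1 by rewrite size_select.
rewrite (@run_step _ _ (IJumpz 3 exit_pc) _ _ _ (Machine exit_pc R M)); first last.
- by rewrite /step [reg _ _]R3.
- by [].
have BW9 : 2 ^ size select * B < W by rewrite size_select BW'.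
have arith : all arithmetic select by [].
rewrite (run_arithmetic _ _ dropE arith B0 RB BW9) {BW9}.
have S5 : exec_all select R 5 = v by apply: select_min.
have S0 : exec_all select R 0 = n by rewrite select_frame.
have S1 : exec_all select R 1 = 0 by rewrite select_frame.
move: (exec_all select R) S5 S0 S1 => S S5 S0 S1.
have [v0|vN0] := eqVneq v 0.
  rewrite (@run_step _ _ (IJumpz 5 halt_pc) _ _ _ (Machine halt_pc S M)); first last.
  - by rewrite /step [reg _ _]S5 v0.
  - by rewrite size_select.
  by rewrite run_halt // S0.
rewrite (@run_step _ _ (IJumpz 5 halt_pc) _ _ _ (Machine (exit_pc + 10) S M)); first last.
- by rewrite /step [reg _ _]S5 (negPf vN0) size_select addnS.
- by rewrite size_select.
rewrite (@run_step _ _ (IAdd 0 5 1) _ _ _ (Machine halt_pc [eta S with 0 |-> v] M)); first last.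
- by rewrite /step [reg _ 5]S5 [reg _ 1]S1 addn0 /set_reg vW.
- by [].
by rewrite run_halt.
Qed.

Lemma run_clobber_program n (c : n.-tuple bool) W t :
  0 < n -> 2 ^ 35 * (n.+1 + n) < W ->
  run W clobber_program (27 + (40 * n + (12 + t))) (input c)
  = Some (if min_closed_cost n c == 0 then n else min_closed_cost n c).
Proof.
move=> n0 BW.
have size_setup : size setup = 27 by [].
have dropE : drop 0 clobber_program = setup ++ drop 27 clobber_program by [].
have arith : all arithmetic setup by [].
set R : nat -> nat := [eta (fun=> 0) with 0 |-> n].
have RB r : R r <= n by rewrite /R /=; case: eqP.
have BWs : 2 ^ size setup * n < W.
  apply: leq_ltn_trans BW; rewrite size_setup; apply: leq_mul.
    by rewrite leq_exp2l.
  by rewrite addSn leqW // leq_addr.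
rewrite -size_setup /input (run_arithmetic _ _ dropE arith n0 RB BWs) add0n -/head_pc.
have Rs : loop_state n c n (exec_all setup R).
  split=> //; first by rewrite /= addn0.
  move=> f q; rewrite setup_cell /cheapest drop_oversize // ?size_tuple //.
have [|||||R' [R's R'B ->]] := @run_loop n c W n _ n.+1 Rs.
- by rewrite size_tuple.
- by [].
- by rewrite size_tuple.
- exact: setup_bound.
- exact: BW.
by apply: (run_select _ _ R's _ R'B BW).
Qed.

Theorem theorem12 : linear_time_computable 3 reducibility_value.
Proof.
(* [53 = 40 + 13], where [13 * n] covers the fixed [27 + 12] instructions since [n >= 3]. The
   exponent is [35 + 2 + 1]: [2 ^ 35 <= n ^ 35], [2 * n + 1 <= n ^ 2], and one more factor for
   strictness. *)
exists clobber_program, 53, 38 => n n3 c.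
have -> : 53 * n = 27 + (40 * n + (12 + (13 * n - 39))) by lia.
rewrite run_clobber_program; last 2 first.
- exact: ltnW (ltnW n3).
- have n0 : 0 < n by exact: ltnW (ltnW n3).
  apply: (@leq_ltn_trans (n ^ 35 * n ^ 2)); last by rewrite -expnD ltn_exp2l // ltnW.
  by apply: leq_mul; [rewrite leq_exp2r // ltnW|nia].
by rewrite -reducibility_value_min // ltnW.
Qed.
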